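(* Let $(A,B)$ be an invertible Jones pair of $n\times n$ complex matrices with $A$ symmetric, and let $d$ satisfy $d^2=n$. Let \[ V=\begin{pmatrix} dA & -dA & B^{(-)} & B^{(-)}\\ -dA & dA & B^{(-)} & B^{(-)}\\ (B^{(-)})^T & (B^{(-)})^T & dA & -dA\\ (B^{(-)})^T & (B^{(-)})^T & -dA & dA \end{pmatrix}. \] Then $\mathcal B\subseteq \mathcal N_V$, where $\mathcal B=\{\mathcal M(F,G,H) : F\in\mathcal N_A,\ G,H\in\mathcal N_{A,B}\}$; that is, $\mathcal B$ is a subscheme of $\mathcal N_V$.
   Context: All matrices are complex. For $m\times m$ matrices $X,Y$, $X\circ Y$ is the Schur (entrywise) product; if $X$ has no zero entry, $X^{(-)}$ is its Schur inverse, $(X^{(-)})_{ij}=1/X_{ij}$. $e_1,\dots,e_m$ denotes the standard basis of $\mathbb C^m$. An $m\times m$ matrix $W$ is type-II if $W(W^{(-)})^T=mI$. For a matrix $C$, $X_C(M)=CM$ and $\Delta_C(M)=C\circ M$ are linear operators on matrices. A Jones pair is a pair $(A,B)$ of $n\times n$ matrices such that $X_A$ and $\Delta_B$ are invertible, $X_A\Delta_BX_A=\Delta_BX_A\Delta_B$ and $X_A\Delta_{B^T}X_A=\Delta_{B^T}X_A\Delta_{B^T}$; it is invertible if moreover $A$ has no zero entry and $B$ is invertible (equivalently, $A$, $B$ type-II). For $m\times m$ matrices $P,Q$ with $P$ invertible and $Q$ without zero entries, $\mathcal N_{P,Q}$ is the set of $m\times m$ matrices $M$ such that each vector $Pe_i\circ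 Qe_j$ ($1\le i,j\le m$) is an eigenvector of $M$; for such $M$, $\Theta_{P,Q}(M)$ is the $m\times m$ matrix with $M(Pe_i\circ Qe_j)=\Theta_{P,Q}(M)_{ij}(Pe_i\circ Qe_j)$. For type-II $P$, $\mathcal N_P:=\mathcal N_{P,P^{(-)}}$ and $\Theta_P:=\Theta_{P,P^{(-)}}$. Standing facts (for an invertible Jones pair $(A,B)$ with $A$ symmetric) needed for the definitions to make sense: $\mathcal N_{A,B}=\mathcal N_{A,B^T}$ is closed under transposition, $\mathcal N_A=\mathcal N_{B^{(-)}}$, and $V$ is type-II. Pairing: for $H\in\mathcal N_{A,B}$, the matrix paired with $H$ is the unique $n\times n$ matrix $K$ with $K^T\in\mathcal N_{A,B^T}$ and $\Theta_{A,B}(H)=\Theta_{A,B^T}(K^T)^T$. For $F\in\mathcal N_A$, $G,H\in\mathcal N_{A,B}$, with $K$ paired with $H$, \[ \mathcal M(F,G,H)=\begin{pmatrix} \Theta_A(F)+H & \Theta_A(F)-H & \Theta_{A,B}(G) & \Theta_{A,B}(G)\\ \Theta_A(F)-H & \Theta_A(F)+H & \Theta_{A,B}(G) & \Theta_{A,B}(G)\\ \Theta_{A,B}(G^T)^T & \Theta_{A,B}(G^T)^T & \Theta_{B^{(-)}}(F)+K & \Theta_{B^{(-)}}(F)-K\\ \Theta_{A,B}(G^T)^T & \Theta_{A,B}(G^T)^T & \Theta_{B^{(-)}}(F)-K & \Theta_{B^{(-)}}(F)+K \end{pmatrix}. \] A subscheme of a Bose–Mesner algebra is a Bose–Mesner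 algebra contained in it (a Bose–Mesner algebra is a space of square matrices containing $I$ and $J$, closed under transpose and Schur product, and commutative under matrix multiplication). *)

(* Defs.v *)
From HB Require Import structures.
From mathcomp Require Import all_boot all_order all_algebra.
From mathcomp Require Import complex.
From mathcomp Require Import boolp classical_sets reals.

Set Implicit Arguments.
Unset Strict Implicit.
Unset Printing Implicit Defensive.

Import GRing.Theory Num.Theory.
Local Open Scope classical_set_scope.
Local Open Scope ring_scope.

Section Definitions.
Variable C : fieldType.

Definition nowhere_zero m k (X : 'M[C]_(m, k)) : Prop :=
  forall i j, X i j != 0.

Definition schur m k (X Y : 'M[C]_(m, k)) : 'M[C]_(m, k) := map2_mx *%R X Y.

(* Entries equal to 0 are sent to 0; only meaningful for nowhere zero X. *)
Definition schur_inv m k (X : 'M[C]_(m, k)) : 'M[C]_(m, k) := map_mx GRing.inv X.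

Definition op_X n (A M : 'M[C]_n) : 'M[C]_n := A *m M.
Definition op_Delta n (B M : 'M[C]_n) : 'M[C]_n := schur B M.

Definition jones_pair n (A B : 'M[C]_n) : Prop :=
  [/\ bijective (op_X A), bijective (op_Delta B),
      op_X A \o op_Delta B \o op_X A =1 op_Delta B \o op_X A \o op_Delta B
    & op_X A \o op_Delta B^T \o op_X A =1 op_Delta B^T \o op_X A \o op_Delta B^T].

Definition invertible_jones_pair n (A B : 'M[C]_n) : Prop :=
  [/\ jones_pair A B, nowhere_zero A & B \in unitmx].

Definition is_eigenvector m (M : 'M[C]_m) (v : 'cV[C]_m) : Prop :=
  v != 0 /\ exists l : C, M *m v = l *: v.

Definition nomura_vec m (P Q : 'M[C]_m) (i j : 'I_m) : 'cV[C]_m :=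
  schur (col i P) (col j Q).

Definition nomura2 m (P Q : 'M[C]_m) : set 'M[C]_m :=
  [set M | forall i j, is_eigenvector M (nomura_vec P Q i j)].

(* Only meaningful for M in nomura2 P Q: then each vector is a nonzero
   eigenvector, so the eigenvalue exists and is unique. *)
Definition Theta2 m (P Q M : 'M[C]_m) : 'M[C]_m :=
  \matrix_(i, j)
    xget 0 [set l : C | M *m nomura_vec P Q i j = l *: nomura_vec P Q i j].

Definition nomura m (P : 'M[C]_m) : set 'M[C]_m := nomura2 P (schur_inv P).
Definition Theta m (P M : 'M[C]_m) : 'M[C]_m := Theta2 P (schur_inv P) M.

(* Existence and uniqueness of K are not built in; they hold for H in
   nomura2 A B when (A, B) is an invertible Jones pair with A symmetric. *)
Definition paired n (A B H : 'M[C]_n) : 'M[C]_n :=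
  xget 0 [set K | nomura2 A B^T K^T /\ Theta2 A B H = (Theta2 A B^T K^T)^T].

Definition block4 n (X11 X12 X13 X14 X21 X22 X23 X24
                     X31 X32 X33 X34 X41 X42 X43 X44 : 'M[C]_n) :
    'M[C]_((n + n) + (n + n)) :=
  block_mx (block_mx X11 X12 X21 X22) (block_mx X13 X14 X23 X24)
           (block_mx X31 X32 X41 X42) (block_mx X33 X34 X43 X44).

Definition V_mx n (d : C) (A B : 'M[C]_n) : 'M[C]_((n + n) + (n + n)) :=
  let dA := d *: A in
  let B' := schur_inv B in
  block4    dA    (- dA)  B'      B'
         (- dA)      dA   B'      B'
          B'^T    B'^T      dA  (- dA)
          B'^T    B'^T   (- dA)    dA.

Definition calM n (A B F G H : 'M[C]_n) : 'M[C]_((n + n) + (n + n)) :=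
  let K := paired A B H in
  let FA := Theta A F in
  let FB := Theta (schur_inv B) F in
  let GG := Theta2 A B G in
  let GT := (Theta2 A B G^T)^T in
  block4 (FA + H) (FA - H)  GG       GG
         (FA - H) (FA + H)  GG       GG
          GT       GT      (FB + K) (FB - K)
          GT       GT      (FB - K) (FB + K).

Definition calB n (A B : 'M[C]_n) : set 'M[C]_((n + n) + (n + n)) :=
  [set M | exists F G H : 'M[C]_n,
    [/\ nomura A F, nomura2 A B G, nomura2 A B H & M = calM A B F G H]].

(* const_mx 1 is J.  Being an algebra, S is also closed under *m. *)
Record bose_mesner m (S : set 'M[C]_m) : Prop := BoseMesner {
  bm_lin : forall (a : C) (X Y : 'M[C]_m), S X -> S Y -> S (a *: X + Y);
  bm_I : S 1%:M;
  bm_J : S (const_mx 1);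
  bm_tr : forall X, S X -> S X^T;
  bm_schur : forall X Y, S X -> S Y -> S (schur X Y);
  bm_mul : forall X Y, S X -> S Y -> S (X *m Y);
  bm_comm : forall X Y, S X -> S Y -> X *m Y = Y *m X
}.

Definition subscheme m (S T : set 'M[C]_m) : Prop :=
  bose_mesner S /\ S `<=` T.

End Definitions.

(* Main.v *)
Require Import Defs.
From mathcomp Require Import all_boot all_order all_algebra.
From mathcomp Require Import complex ring.
From mathcomp Require Import boolp classical_sets reals.

(* For type-II matrices P, Q the eigenvector equations
   M (P e_i o Q e_j) = S_ij (P e_i o Q e_j) are a star-triangle relation, which
   type-II orthogonality turns into an equivalent relation with the roles of M
   and S exchanged.  Composing such relations gives all product rules between
   N_P, N_{P,Q} and their images under Theta, in particular that N_P is a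
   Bose-Mesner algebra.
   The braid relations say A in N_{A,B} and A in N_{A,B^T}, with Theta images B
   and B^T.  Comparing traces and diagonals of the resulting conjugations shows
   that A and B are type-II.  Schur multiplication by A then identifies N_{A,B}
   and N_{A,B^T} with N_A = N_{B^s}, which yields the pairing.
   Finally, the products V e_i o V^s e_j are, up to scalars, even vectors
   (u, u, v, v) and odd vectors (u, -u, v, -v), so a matrix of the block shape of
   M(F,G,H) lies in N_V exactly when it is in calB.  Hence calB is the
   intersection of N_V with an algebra closed under transpose and Schur product
   that contains I and J. *)

Set Implicit Arguments.
Unset Strict Implicit.
Unset Printing Implicit Defensive.

Import GRing.Theory Num.Theory.
Local Open Scope ring_scope.

Local Notation "X ⊙ Y" := (schur X Y) (at level 40, left associativity).
Local Notation "X ^s" := (schur_inv X) (at level 2, format "X ^s").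

(** * Entrywise products, entrywise inverses and the vectors [P e_i o Q e_j] *)

Section SchurProduct.
Variable C : fieldType.

Lemma schurE m k (X Y : 'M[C]_(m, k)) i j : (X ⊙ Y) i j = X i j * Y i j.
Proof. by rewrite mxE. Qed.

Lemma schur_invE m k (X : 'M[C]_(m, k)) i j : X^s i j = (X i j)^-1.
Proof. by rewrite mxE. Qed.

Lemma schur_invK m k (X : 'M[C]_(m, k)) : X^s^s = X.
Proof. by apply/matrixP => i j; rewrite !mxE invrK. Qed.

Lemma tr_schur_inv m k (X : 'M[C]_(m, k)) : X^s^T = X^T^s.
Proof. by apply/matrixP => i j; rewrite !mxE. Qed.

Lemma tr_schur m k (X Y : 'M[C]_(m, k)) : (X ⊙ Y)^T = X^T ⊙ Y^T.
Proof. by apply/matrixP => i j; rewrite !mxE. Qed.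

Lemma schurC m k (X Y : 'M[C]_(m, k)) : X ⊙ Y = Y ⊙ X.
Proof. by apply/matrixP => i j; rewrite !mxE mulrC. Qed.

Lemma schurA m k (X Y Z : 'M[C]_(m, k)) : X ⊙ (Y ⊙ Z) = X ⊙ Y ⊙ Z.
Proof. by apply/matrixP => i j; rewrite !mxE mulrA. Qed.

Lemma schurKV m k (X Y : 'M[C]_(m, k)) : nowhere_zero X -> X^s ⊙ (X ⊙ Y) = Y.
Proof. by move=> hX; apply/matrixP => i j; rewrite !mxE mulKf. Qed.

Lemma schurVK m k (X Y : 'M[C]_(m, k)) : nowhere_zero X -> X ⊙ (X^s ⊙ Y) = Y.
Proof. by move=> hX; apply/matrixP => i j; rewrite !mxE mulVKf. Qed.

Lemma nowhere_zero_inv m k (X : 'M[C]_(m, k)) :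
  nowhere_zero X -> nowhere_zero X^s.
Proof. by move=> hX i j; rewrite mxE invr_eq0. Qed.

Lemma nowhere_zero_tr m k (X : 'M[C]_(m, k)) :
  nowhere_zero X -> nowhere_zero X^T.
Proof. by move=> hX i j; rewrite mxE. Qed.

Lemma nomura_vecE m (P Q : 'M[C]_m) i j k l :
  nomura_vec P Q i j k l = P k i * Q k j.
Proof. by rewrite !mxE. Qed.

Lemma nomura_vecC m (P Q : 'M[C]_m) i j : nomura_vec P Q i j = nomura_vec Q P j i.
Proof. by rewrite /nomura_vec schurC. Qed.

Lemma nomura_vec_neq0 m (P Q : 'M[C]_m) i j :
  P \in unitmx -> nowhere_zero Q -> nomura_vec P Q i j != 0.
Proof.
move=> uP hQ; apply/eqP => v0.
have c0 : col i P = 0.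
  apply/colP => k; move/colP: v0 => /(_ k); rewrite nomura_vecE !mxE => /eqP.
  by rewrite mulf_eq0 (negPf (hQ _ _)) orbF => /eqP.
have : col i (1%:M : 'M[C]_m) = 0.
  by rewrite -(mulVmx uP) !colE -mulmxA -colE c0 mulmx0.
by move/colP/(_ i)/eqP; rewrite !mxE eqxx oner_eq0.
Qed.

End SchurProduct.

(** * Star-triangle relations and the exchange of operator and coefficients *)

Section StarTriangle.
Variable C : fieldType.

(** Source and target vectors may differ, since exchanging [M] and [S] does not preserve the pair
    [P], [Q]. Equal pairs give [nomura_pair], which for type-II matrices says that [M] lies in
    N_{P,Q} with Theta image [S]. *)
Definition star_triangle m (M S P Q P' Q' : 'M[C]_m) : Prop :=
  forall i j, M *m nomura_vec P Q i j = S i j *: nomura_vec P' Q' i j.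

Definition nomura_pair m (P Q M S : 'M[C]_m) : Prop := star_triangle M S P Q P Q.

Definition type2 m (P : 'M[C]_m) : Prop :=
  nowhere_zero P /\ P *m P^s^T = m%:R%:M.

Variable m : nat.
Implicit Types M S P Q G H F : 'M[C]_m.

Lemma star_triangleP M S P Q P' Q' :
  star_triangle M S P Q P' Q' <->
  forall k i j, \sum_l M k l * (P l i * Q l j) = S i j * (P' k i * Q' k j).
Proof.
split=> [st k i j | st i j].
  move/colP/(_ k): (st i j); rewrite !mxE => <-.
  by apply: eq_bigr => l _; rewrite nomura_vecE.
apply/colP => k; rewrite !mxE -st.
by apply: eq_bigr => l _; rewrite nomura_vecE.
Qed.

Lemma star_triangle_swap M S P Q P' Q' :
  star_triangle M S P Q P' Q' -> star_triangle M S^T Q P Q' P'.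
Proof. by move=> st i j; rewrite nomura_vecC st mxE nomura_vecC. Qed.

Lemma star_triangle_comp M S M' S' P Q P' Q' P'' Q'' :
  star_triangle M S P Q P' Q' -> star_triangle M' S' P' Q' P'' Q'' ->
  star_triangle (M' *m M) (S ⊙ S') P Q P'' Q''.
Proof.
by move=> st st' i j; rewrite -mulmxA st -scalemxAr st' scalerA schurE.
Qed.

Lemma star_triangle_inv M S P Q P' Q' :
  M \in unitmx -> nowhere_zero S ->
  star_triangle M S P Q P' Q' -> star_triangle (invmx M) S^s P' Q' P Q.
Proof.
move=> uM hS st i j; apply: (can_inj (mulKmx uM)).
by rewrite mulKVmx // -scalemxAr st scalerA schur_invE mulVf // scale1r.
Qed.

Lemma star_triangleZ a M S P Q P' Q' :
  star_triangle M S P Q P' Q' -> star_triangle (a *: M) (a *: S) P Q P' Q'.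
Proof. by move=> st i j; rewrite -scalemxAl st scalerA mxE. Qed.

Lemma star_triangleD M S M' S' P Q P' Q' :
  star_triangle M S P Q P' Q' -> star_triangle M' S' P Q P' Q' ->
  star_triangle (M + M') (S + S') P Q P' Q'.
Proof. by move=> st st' i j; rewrite mulmxDl st st' mxE scalerDl. Qed.

Lemma star_triangle_injS M S S' P Q P' Q' :
  P' \in unitmx -> nowhere_zero Q' ->
  star_triangle M S P Q P' Q' -> star_triangle M S' P Q P' Q' -> S = S'.
Proof.
move=> uP hQ st st'; apply/matrixP => i j.
move: (st i j); rewrite st' => /eqP; rewrite -subr_eq0 -scalerBl scaler_eq0.
by rewrite (negPf (nomura_vec_neq0 _ _ uP hQ)) orbF subr_eq0 => /eqP ->.
Qed.

(* For fixed j the vectors P e_i o Q e_j, 1 <= i <= m, form a basis. *)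
Lemma star_triangle_injM M M' S P Q P' Q' :
  P \in unitmx -> nowhere_zero Q ->
  star_triangle M S P Q P' Q' -> star_triangle M' S P Q P' Q' -> M = M'.
Proof.
move=> uP hQ /star_triangleP st /star_triangleP st'.
suff e j k : M k j * Q j j = M' k j * Q j j.
  by apply/matrixP => k j; apply: (mulIf (hQ j j)).
have rowE (N : 'M_m) i :
    \sum_l N k l * (P l i * Q l j) = ((\row_l (N k l * Q l j)) *m P) 0 i.
  by rewrite mxE; apply: eq_bigr => l _; rewrite mxE mulrCA mulrC.
have : (\row_l (M k l * Q l j)) *m P = (\row_l (M' k l * Q l j)) *m P.
  by apply/rowP => i; rewrite -!rowE st st'.
by move/(can_inj (mulmxK uP))/rowP/(_ j); rewrite !mxE.
Qed.

Hypothesis m_neq0 : m%:R != 0 :> C.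

Lemma type2_mulVmx P : type2 P -> P^s^T *m P = m%:R%:M.
Proof.
move=> [_ e].
have /mulmx1C : P *m (m%:R^-1 *: P^s^T) = 1%:M.
  by rewrite -scalemxAr e scale_scalar_mx mulVf.
rewrite -scalemxAl => /(congr1 ( *:%R m%:R)).
by rewrite scalerA divff // scale1r scale_scalar_mx mulr1.
Qed.

Lemma type2_unit P : type2 P -> P \in unitmx.
Proof.
move=> tP; have /mulmx1_unit[] // : P *m (m%:R^-1 *: P^s^T) = 1%:M.
by rewrite -scalemxAr tP.2 scale_scalar_mx mulVf.
Qed.

Lemma type2_tr P : type2 P -> type2 P^T.
Proof.
move=> tP; split; first exact: nowhere_zero_tr tP.1.
by rewrite -tr_schur_inv -trmx_mul type2_mulVmx // tr_scalar_mx.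
Qed.

Lemma type2_inv P : type2 P -> type2 P^s.
Proof.
move=> tP; split; first exact: nowhere_zero_inv tP.1.
by rewrite schur_invK -[P^s]trmxK -trmx_mul tP.2 tr_scalar_mx.
Qed.

Lemma type2_orth P r l : type2 P ->
  \sum_i P l i * (P r i)^-1 = if l == r then m%:R else 0.
Proof.
case=> _ /matrixP /(_ l r); rewrite !mxE -mulrb => <-.
by apply: eq_bigr => i _; rewrite !mxE.
Qed.

(* Sum the star-triangle relation against the rows of P^s. *)
Lemma star_triangle_exchange M S P Q P' Q' :
  type2 P -> nowhere_zero Q' ->
  star_triangle M S P Q P' Q' ->
  star_triangle S^T (m%:R *: M) P'^T P^s^T Q'^s^T Q^T.
Proof.
move=> tP hQ' /star_triangleP st; apply/star_triangleP => j k r.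
have lhsE : \sum_i (\sum_l M k l * (P l i * Q l j)) * (P r i)^-1 =
            m%:R * (M k r * Q r j).
  under eq_bigr => i _ do rewrite mulr_suml.
  rewrite exchange_big /=.
  transitivity (\sum_l M k l * Q l j * (if l == r then m%:R else 0)).
    apply: eq_bigr => l _; rewrite -(type2_orth r l tP) mulr_sumr.
    by apply: eq_bigr => i _; ring.
  rewrite (bigD1 r) //= eqxx big1 ?addr0 1?mulrC // => l /negPf->.
  by rewrite mulr0.
have rhsE : \sum_i S^T j i * (P'^T i k * P^s^T i r) =
    (\sum_i (S i j * (P' k i * Q' k j)) * (P r i)^-1) * (Q' k j)^-1.
  rewrite mulr_suml; apply: eq_bigr => i _; rewrite !mxE.
  by field; rewrite hQ' tP.1.
rewrite rhsE; under eq_bigr => i _ do rewrite -st.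
by rewrite lhsE !mxE; ring.
Qed.

End StarTriangle.

(** * Duality and product rules for Nomura algebras of type-II matrices *)

Section NomuraDuality.
Variables (C : fieldType) (m : nat).
Hypothesis m_neq0 : m%:R != 0 :> C.
Implicit Types M S P Q G H F T U : 'M[C]_m.

Lemma star_triangleZK a M S P Q P' Q' : a != 0 ->
  star_triangle (a *: M) (a *: S) P Q P' Q' -> star_triangle M S P Q P' Q'.
Proof. by move=> a0 /(star_triangleZ a^-1); rewrite !scalerK. Qed.

(** Two exchanges bring back [M] and [S], both transposed and scaled by [m]; a swap of the two
    vector indices undoes the transposition of [S]. *)
Lemma star_triangle_tr M S P Q P' Q' :
  type2 P -> type2 P' -> nowhere_zero Q -> nowhere_zero Q' ->
  star_triangle M S P Q P' Q' -> star_triangle M^T S P'^s Q'^s P^s Q^s.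
Proof.
move=> tP tP' hQ hQ' /(star_triangle_exchange tP hQ').
move/(star_triangle_exchange (type2_tr m_neq0 tP') (nowhere_zero_tr hQ)).
rewrite !linearZ /= !tr_schur_inv !trmxK => /(star_triangleZK m_neq0).
by move/star_triangle_swap; rewrite trmxK.
Qed.

Lemma nomura_pair_swap P Q M S : nomura_pair P Q M S <-> nomura_pair Q P M S^T.
Proof. by split=> /star_triangle_swap; rewrite ?trmxK. Qed.

Lemma nomura_pair_tr P Q M S : type2 P -> nowhere_zero Q ->
  nomura_pair P Q M S -> nomura_pair P^s Q^s M^T S.
Proof. by move=> tP hQ; apply: star_triangle_tr. Qed.

(** Here the image [S] is the operator, so that matrix products of images become compositions. For
    the converse, a second exchange returns [M] transposed, on the inverted vectors, which
    [nomura_pair_tr] undoes. *)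
Lemma nomura_pair_dual P Q M S : type2 P -> type2 Q ->
  nomura_pair P Q M S <-> star_triangle S (m%:R *: M) Q^T Q^s^T P^s^T P^T.
Proof.
move=> tP tQ; split.
  move/star_triangle_swap/(star_triangle_exchange tQ tP.1).
  by rewrite trmxK.
move/(star_triangle_exchange (type2_tr m_neq0 tQ) (nowhere_zero_tr tP.1)).
rewrite linearZ /= !tr_schur_inv !trmxK => /(star_triangleZK m_neq0).
move/(nomura_pair_tr (type2_inv tP) (nowhere_zero_inv tQ.1)).
by rewrite trmxK !schur_invK.
Qed.

Lemma nomura_pair_dual_swap P Q M S : type2 P -> type2 Q ->
  nomura_pair P Q M S <-> star_triangle S^T (m%:R *: M) P^T P^s^T Q^s^T Q^T.
Proof.
by move=> tP tQ; rewrite nomura_pair_swap; apply: nomura_pair_dual.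
Qed.

Lemma nomura_pairM P Q M S M' S' : nomura_pair P Q M S ->
  nomura_pair P Q M' S' -> nomura_pair P Q (M' *m M) (S ⊙ S').
Proof. exact: star_triangle_comp. Qed.

Lemma nomura_pair_uniqS P Q M S S' : type2 P -> type2 Q ->
  nomura_pair P Q M S -> nomura_pair P Q M S' -> S = S'.
Proof. by move=> /(type2_unit m_neq0) uP tQ; apply: star_triangle_injS tQ.1. Qed.

Lemma nomura_pair_uniqM P Q M M' S : type2 P -> type2 Q ->
  nomura_pair P Q M S -> nomura_pair P Q M' S -> M = M'.
Proof. by move=> /(type2_unit m_neq0) uP tQ; apply: star_triangle_injM tQ.1. Qed.

Lemma schurZl a M M' : (a *: M) ⊙ M' = a *: (M ⊙ M').
Proof. by apply/matrixP => i j; rewrite !mxE mulrA. Qed.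

Lemma schurZr a M M' : M ⊙ (a *: M') = a *: (M ⊙ M').
Proof. by rewrite schurC schurZl schurC. Qed.

(** Dually, [T] carries [Q]-vectors to [P]-vectors and [S] rescales [P]-vectors; composing them
    multiplies the coefficients entrywise. *)
Lemma nomura_pair_mull P Q F S G T : type2 P -> type2 Q ->
  nomura_pair P P^s F S -> nomura_pair P Q G T ->
  nomura_pair P Q (m%:R *: (F ⊙ G)) (S *m T).
Proof.
move=> tP tQ /(nomura_pair_dual _ _ tP (type2_inv tP)) dF.
move/(nomura_pair_dual _ _ tP tQ) => dG.
apply/nomura_pair_dual => //.
rewrite schur_invK in dF; move: (star_triangle_comp dG dF).
by rewrite schurZl schurZr (schurC G).
Qed.

Lemma nomura_pair_mulr P Q F S G T : type2 P -> type2 Q ->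
  nomura_pair Q^s Q F S -> nomura_pair P Q G T ->
  nomura_pair P Q (m%:R *: (F ⊙ G)) (T *m S).
Proof.
move=> tP tQ /(nomura_pair_dual _ _ (type2_inv tQ) tQ) dF.
move/(nomura_pair_dual _ _ tP tQ) => dG.
apply/nomura_pair_dual => //.
rewrite schur_invK in dF; move: (star_triangle_comp dF dG).
by rewrite schurZl schurZr.
Qed.

(** Dually, [T] goes from [Q]-vectors to [P]-vectors and [U^T] goes back; the two orders of
    composition give the two claims. *)
Lemma nomura_pair_mul_tr P Q G T H U : type2 P -> type2 Q ->
  nomura_pair P Q G T -> nomura_pair P Q H U ->
  nomura_pair P P^s (m%:R *: (G ⊙ H^T)) (T *m U^T) /\
  nomura_pair Q^s Q (m%:R *: (G ⊙ H^T)) (U^T *m T).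
Proof.
move=> tP tQ /(nomura_pair_dual _ _ tP tQ) dG.
move/(nomura_pair_dual_swap _ _ tP tQ)/star_triangle_swap; rewrite linearZ => dH.
split; apply/nomura_pair_dual; rewrite ?schur_invK //; try exact: type2_inv.
  by move: (star_triangle_comp dH dG); rewrite schurZl schurZr (schurC H^T).
by move: (star_triangle_comp dG dH); rewrite schurZl schurZr.
Qed.

Lemma nomura_dual P M S : type2 P ->
  nomura_pair P P^s M S -> nomura_pair P^T P^T^s S (m%:R *: M^T).
Proof.
move=> tP /(nomura_pair_dual _ _ tP (type2_inv tP)) /star_triangle_swap.
by rewrite linearZ /= schur_invK tr_schur_inv.
Qed.

Lemma nomura_tr P M S : type2 P ->
  nomura_pair P P^s M S -> nomura_pair P P^s M^T S^T.
Proof.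
move=> tP /(nomura_pair_tr tP (nowhere_zero_inv tP.1)).
by rewrite schur_invK => /nomura_pair_swap.
Qed.

Lemma nomura_pair_1 P Q : nomura_pair P Q 1%:M (const_mx 1).
Proof. by move=> i j; rewrite mul1mx mxE scale1r. Qed.

Lemma nomura_pairP P Q M : type2 P -> type2 Q ->
  nomura2 P Q M <-> exists S, nomura_pair P Q M S.
Proof.
move=> tP tQ; split=> [h | [S hS] i j]; last first.
  split; last by exists (S i j).
  exact: nomura_vec_neq0 (type2_unit m_neq0 tP) tQ.1.
have [S hS] := choice (fun ij : 'I_m * 'I_m => (h ij.1 ij.2).2).
by exists (\matrix_(i, j) S (i, j)) => i j; rewrite mxE (hS (i, j)).
Qed.

Lemma Theta2P P Q M S : type2 P -> type2 Q ->
  nomura_pair P Q M S -> Theta2 P Q M = S.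
Proof.
move=> tP tQ hS; apply/matrixP => i j; rewrite mxE.
apply: xget_unique => [|l /=]; first exact: hS.
rewrite hS => /eqP; rewrite -subr_eq0 -scalerBl scaler_eq0.
rewrite (negPf (nomura_vec_neq0 _ _ (type2_unit m_neq0 tP) tQ.1)) orbF.
by rewrite subr_eq0 => /eqP ->.
Qed.

Lemma nomura_Theta P Q M : type2 P -> type2 Q ->
  nomura2 P Q M -> nomura_pair P Q M (Theta2 P Q M).
Proof. by move=> tP tQ /nomura_pairP [] // S hS; rewrite (Theta2P tP tQ hS). Qed.

Lemma nomuraP P M : type2 P ->
  nomura P M <-> exists S, nomura_pair P P^s M S.
Proof. by move=> tP; apply: nomura_pairP (type2_inv tP). Qed.

(** J is the dual of the identity in the algebra of [P^T], and Schur closure is the left product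
    rule. Commutativity holds because Theta is injective and turns matrix products into Schur
    products. *)
Lemma nomura_bose_mesner P : type2 P -> bose_mesner (nomura P).
Proof.
move=> tP; have tP' := type2_tr m_neq0 tP.
split.
- move=> a X Y /nomuraP [] // S hS /nomuraP [] // T hT; apply/nomuraP => //.
  exists (a *: S + T); apply: star_triangleD hT; exact: star_triangleZ.
- by apply/nomuraP => //; exists (const_mx 1); apply: nomura_pair_1.
- apply/nomuraP => //; exists (m%:R *: 1%:M).
  by move: (nomura_dual tP' (nomura_pair_1 P^T P^T^s)); rewrite trmxK trmx1.
- move=> X /nomuraP [] // S hS; apply/nomuraP => //.
  by exists S^T; apply: nomura_tr.
- move=> X Y /nomuraP [] // S hS /nomuraP [] // T hT; apply/nomuraP => //.
  exists (m%:R^-1 *: (S *m T)); apply: (@star_triangleZK m%:R) => //.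
  by rewrite scalerA divff // scale1r; apply: nomura_pair_mull (type2_inv tP) hS hT.
- move=> X Y /nomuraP [] // S hS /nomuraP [] // T hT; apply/nomuraP => //.
  by exists (T ⊙ S); apply: nomura_pairM.
move=> X Y /nomuraP [] // S hS /nomuraP [] // T hT.
apply: nomura_pair_uniqM tP (type2_inv tP) _ (nomura_pairM hS hT).
by rewrite schurC; apply: nomura_pairM.
Qed.

End NomuraDuality.

(** * Comparison of N_A, N_{B^s} and N_{A,B} for symmetric [A] *)

Section SymmetricNomura.
Variables (C : fieldType) (n : nat) (A B : 'M[C]_n).
Hypotheses (n_neq0 : n%:R != 0 :> C) (symA : A^T = A).
Hypotheses (tA : type2 A) (tB : type2 B) (hAB : nomura_pair A B A B).
Implicit Types F G H S : 'M[C]_n.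

Lemma nomura2ZK m (P Q M : 'M[C]_m) a : a != 0 ->
  nomura2 P Q (a *: M) -> nomura2 P Q M.
Proof.
move=> a0 h i j; have [v0 [l e]] := h i j; split=> //; exists (a^-1 * l).
by rewrite -scalerA -e -scalemxAl scalerK.
Qed.

Let tB' : type2 B^s := type2_inv tB.

(** The base point of N_{A,B} is [A] itself, with image [B]; the left product rule is applied to
    it. *)
Lemma nomura_schur_base F : nomura A F -> nomura2 A B (A ⊙ F).
Proof.
move=> /nomuraP [] // S hS; apply: (nomura2ZK n_neq0); apply/nomura_pairP => //.
by exists (S *m B); rewrite schurC; apply: nomura_pair_mull.
Qed.

Lemma nomuraB_schur_base F : nomura B^s F -> nomura2 A B (A ⊙ F).
Proof.
move=> /nomuraP [] // S; rewrite schur_invK => hS.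
apply: (nomura2ZK n_neq0); apply/nomura_pairP => //.
by exists (B *m S); rewrite schurC; apply: nomura_pair_mulr.
Qed.

Lemma nomura2_schur_base H :
  nomura2 A B H -> nomura A (A ⊙ H^T) /\ nomura B^s (A ⊙ H^T).
Proof.
move=> /nomura_pairP [] // S hS.
have [h1 h2] := nomura_pair_mul_tr n_neq0 tA tB hAB hS.
split; apply: (nomura2ZK n_neq0); apply/nomuraP => //.
  by exists (B *m S^T).
by exists (S^T *m B); rewrite schur_invK.
Qed.

(* B B^T is an invertible element of N_A with Theta_A (B B^T) = n^2 (A o A);
   Theta_A maps its inverse to a multiple of the Schur inverse of A o A. *)
Lemma nomura_sqV : nomura A (A^s ⊙ A^s).
Proof.
have [h _] := nomura_pair_mul_tr n_neq0 tA tB hAB hAB.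
have := nomura_dual n_neq0 tA h; rewrite symA linearZ /= tr_schur symA scalerA.
have uB := type2_unit n_neq0 tB.
have uBB : B *m B^T \in unitmx by rewrite unitmx_mul unitmx_tr uB.
have nn0 : (n%:R * n%:R)^-1 != 0 :> C by rewrite invr_eq0 mulf_neq0.
move/(star_triangle_inv uBB) => /(_ _)/(nomura_dual n_neq0 tA).
have -> : ((n%:R * n%:R) *: (A ⊙ A))^s = (n%:R * n%:R)^-1 *: (A^s ⊙ A^s).
  by apply/matrixP => i j; rewrite !mxE !invfM mulrA.
rewrite symA => hI; apply: (nomura2ZK nn0); apply/nomuraP => //.
eexists; apply: hI => i j; rewrite !mxE !mulf_neq0 //; exact: tA.1.
Qed.

Lemma nomura_sqVM F : nomura A F -> nomura A (A^s ⊙ (A^s ⊙ F)).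
Proof.
move=> hF; rewrite schurA.
exact: (bm_schur (nomura_bose_mesner n_neq0 tA)) nomura_sqV hF.
Qed.

(** Schur multiplication by [A] climbs to N_{A,B}, and a second one descends to either algebra up to
    a transpose. The resulting factor [A o A] is always divided out inside N_A: before climbing in
    one direction, after descending in the other. *)
Lemma nomura_eq F : nomura A F <-> nomura B^s F.
Proof.
have bA := nomura_bose_mesner n_neq0 tA.
have bB := nomura_bose_mesner n_neq0 tB'.
have hA := tA.1.
split=> hF.
  have /nomura_schur_base/nomura2_schur_base[_ /(bm_tr bB)] := nomura_sqVM hF.
  by rewrite tr_schur trmxK symA !schurVK.
have /nomuraB_schur_base/nomura2_schur_base[/nomura_sqVM h _] := bm_tr bB hF.
by move: h; rewrite tr_schur symA trmxK !schurKV.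
Qed.

Lemma nomura2_iff H : nomura2 A B H <-> nomura A (A^s ⊙ H).
Proof.
split=> [/nomura2_schur_base [/nomura_sqVM h _] | /nomura_schur_base].
  move: h; rewrite schurKV; last exact: tA.1.
  move/(bm_tr (nomura_bose_mesner n_neq0 tA)).
  by rewrite tr_schur tr_schur_inv symA trmxK.
by rewrite schurVK //; apply: tA.1.
Qed.

(** Both sides are the image under Theta_{A,B} of [n (F o A)], computed by the left and by the right
    product rule. *)
Lemma nomura_Theta_intertwine F S S1 :
  nomura_pair A A^s F S -> nomura_pair B^s B F S1 -> S *m B = B *m S1.
Proof.
move=> hS hS1; apply: (nomura_pair_uniqS n_neq0 tA tB).
  exact: (nomura_pair_mull n_neq0 tA tB hS hAB).
exact: nomura_pair_mulr.
Qed.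

End SymmetricNomura.

(** * The pairing between N_{A,B} and N_{A,B^T} *)

Section Pairing.
Variables (C : fieldType) (n : nat) (A B : 'M[C]_n).
Hypotheses (n_neq0 : n%:R != 0 :> C) (symA : A^T = A).
Hypotheses (tA : type2 A) (tB : type2 B).
Hypotheses (hAB : nomura_pair A B A B) (hABT : nomura_pair A B^T A B^T).
Implicit Types F G H S : 'M[C]_n.

Let tB' : type2 B^s := type2_inv tB.
Let tBT : type2 B^T := type2_tr n_neq0 tB.
Let tBT' : type2 B^T^s := type2_inv tBT.

(* Theta_A and Theta_{B^s} commute on N_A = N_{B^s}, with composite n F'. *)
Lemma Theta_comm F S S1 :
  nomura_pair A A^s F S -> nomura_pair B^s B F S1 ->
  exists F', [/\ nomura_pair A A^s S1 (n%:R *: F'),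
    nomura_pair B^s B S (n%:R *: F') & nomura_pair A A^s F' S1^T].
Proof.
move=> hS hS1.
(* Duality places [S1] in the algebra of [B^T^s], which equals N_A because [A], [B^T] satisfy the
   same relation; [F'] is then its image divided by [n]. *)
have : nomura B^T^s S1.
  apply/nomuraP => //; exists (n%:R *: F^T).
  by rewrite -tr_schur_inv; apply: nomura_dual => //; rewrite schur_invK.
move/(nomura_eq n_neq0 symA tA tBT hABT)/(nomuraP n_neq0 _ tA) => [X hX].
exists (n%:R^-1 *: X); rewrite scalerA divff // scale1r.
have hF' : nomura_pair A A^s (n%:R^-1 *: X) S1^T.
  have := nomura_dual n_neq0 tA hX.
  by rewrite symA => /(star_triangleZ n%:R^-1); rewrite scalerK.
split=> //.
have /(nomura_eq n_neq0 symA tA tBT hABT) : nomura A (n%:R^-1 *: X).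
  by apply/nomuraP => //; exists S1^T.
move=> /nomuraP [] // Y hY.
(* Intertwining for [B^T] gives [S1^T B^T = B^T Y], while transposing [S B = B S1] gives
   [S1^T B^T = B^T S^T]; now cancel [B^T]. *)
have eY : Y = S^T.
  move: hY (hY); rewrite {2}schur_invK => hY'.
  move/(nomura_Theta_intertwine n_neq0 tA tBT hABT hF').
  rewrite -trmx_mul -(nomura_Theta_intertwine n_neq0 tA tB hAB hS hS1) trmx_mul.
  by move/(can_inj (mulKmx (type2_unit n_neq0 tBT))).
move: (nomura_dual n_neq0 tBT' hY); rewrite eY !tr_schur_inv trmxK.
move/(nomura_tr n_neq0 tB'); rewrite trmxK !linearZ /= trmxK schur_invK.
by rewrite scalerA divff // scale1r.
Qed.

(** The last two relations say that [H^T] is paired with [K^T], so the pairing respects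
    transposition. *)
Lemma pairing_ex H : nomura2 A B H -> exists K T U,
  [/\ nomura_pair A B H T, nomura_pair A B^T K^T T^T,
      nomura_pair A B H^T U & nomura_pair A B^T K U^T].
Proof.
move=> /(nomura2_iff n_neq0 symA tA tB hAB) => hF.
have hA := tA.1.
have /nomuraP[//|//|S hS] := hF.
have /(nomura_eq n_neq0 symA tA tB hAB)/nomuraP[//|//|S1] := hF.
rewrite schur_invK => hS1.
have [F' [_ _ hF']] := Theta_comm hS hS1.
have hST := nomura_tr n_neq0 tA hS.
have hS1T : nomura_pair B^s B (A^s ⊙ H)^T S1^T.
  by have := nomura_tr n_neq0 tB'; rewrite schur_invK; apply.
have hFT := nomura_tr n_neq0 tA hF'; rewrite trmxK in hFT.
(* With [F = A^s o H], the image of [H = F o A] is [S B / n = B S1 / n]. Its transpose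
   [S1^T B^T / n] is the image of [F' o A] for the pair [A], [B^T], hence [K^T = F' o A]. *)
exists (F'^T ⊙ A), (n%:R^-1 *: (S *m B)), (n%:R^-1 *: (S^T *m B)).
have e1 := nomura_Theta_intertwine n_neq0 tA tB hAB hS hS1.
have e2 := nomura_Theta_intertwine n_neq0 tA tB hAB hST hS1T.
have HT : (A^s ⊙ H)^T ⊙ A = H^T.
  by rewrite schurC tr_schur tr_schur_inv symA schurVK.
split; apply: (star_triangleZK n_neq0);
  rewrite ?[(n%:R^-1 *: _)^T]linearZ /= scalerA divff // scale1r.
- rewrite -[X in n%:R *: X](schurVK _ hA) schurC.
  exact: nomura_pair_mull hS hAB.
- rewrite e1 trmx_mul tr_schur trmxK symA.
  exact: nomura_pair_mull hF' hABT.
- by rewrite -HT; apply: nomura_pair_mull hST hAB.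
rewrite e2 trmx_mul trmxK; exact: nomura_pair_mull hFT hABT.
Qed.

Lemma pairedP H K T : nomura_pair A B H T -> nomura_pair A B^T K^T T^T ->
  paired A B H = K.
Proof.
move=> hH hK; have tH := Theta2P n_neq0 tA tB hH.
apply: xget_unique => [|K' [hK' e]].
  split; first by apply/nomura_pairP => //; exists T^T.
  by rewrite tH (Theta2P n_neq0 tA tBT hK) trmxK.
apply: trmx_inj; apply: (nomura_pair_uniqM n_neq0 tA tBT) hK.
rewrite -tH e trmxK; exact: nomura_Theta.
Qed.

End Pairing.

(** * The algebra of matrices with the block shape of [calM] *)

Section BlockStructure.
Variables (C : fieldType) (n : nat).
Implicit Types P H G Q K M : 'M[C]_n.
Implicit Types u v : 'cV[C]_n.

(** The six blocks are left unrelated, so that closure of the shape can be checked without the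
    relations that tie the blocks of [calM] together. *)
Definition coblock P H G G' Q K : 'M[C]_((n + n) + (n + n)) :=
  block4 (P + H) (P - H) G       G
         (P - H) (P + H) G       G
         G'      G'      (Q + K) (Q - K)
         G'      G'      (Q - K) (Q + K).

Definition vec4 (x y z w : 'cV[C]_n) : 'cV[C]_((n + n) + (n + n)) :=
  col_mx (col_mx x y) (col_mx z w).

Definition shift4 (s t : bool) (i : 'I_n) : 'I_((n + n) + (n + n)) :=
  let j := if t then rshift n i else lshift n i in
  if s then rshift (n + n) j else lshift (n + n) j.

Lemma shift4P (k : 'I_((n + n) + (n + n))) : exists s t i, k = shift4 s t i.
Proof.
case: (split_ordP k) => j ->; case: (split_ordP j) => i ->.
- by exists false, false, i.
- by exists false, true, i.
- by exists true, false, i.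
by exists true, true, i.
Qed.

Lemma eq_shift4_mx p (X Y : 'M[C]_((n + n) + (n + n), p)) :
  (forall s t k j, X (shift4 s t k) j = Y (shift4 s t k) j) -> X = Y.
Proof.
by move=> e; apply/matrixP => k j; have [s [t [i ->]]] := shift4P k.
Qed.

Lemma eq_shift4 (X Y : 'M[C]_((n + n) + (n + n))) :
  (forall s t k s' t' l,
    X (shift4 s t k) (shift4 s' t' l) = Y (shift4 s t k) (shift4 s' t' l)) ->
  X = Y.
Proof.
by move=> e; apply: eq_shift4_mx => s t k j; have [s' [t' [l ->]]] := shift4P j.
Qed.

Lemma vec4E x y z w s t k j : vec4 x y z w (shift4 s t k) j =
  if s then if t then w k j else z k j else if t then y k j else x k j.
Proof.
by case: s t => [] []; rewrite /vec4 /shift4 ?(col_mxEu, col_mxEd).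
Qed.

Lemma coblockE P H G G' Q K s t k s' t' l :
  coblock P H G G' Q K (shift4 s t k) (shift4 s' t' l) =
  if s == s'
  then if s then Q k l + (-1) ^+ (t (+) t') * K k l
       else P k l + (-1) ^+ (t (+) t') * H k l
  else if s then G' k l else G k l.
Proof.
case: s t s' t' => [] [] [] []; rewrite /coblock /block4 /shift4 /=;
by rewrite ?(block_mxEul, block_mxEur, block_mxEdl, block_mxEdr) ?mxE
  ?(expr0, expr1, mul1r, mulN1r).
Qed.

Lemma coblock_lin a P H G G' Q K P2 H2 G2 G2' Q2 K2 :
  a *: coblock P H G G' Q K + coblock P2 H2 G2 G2' Q2 K2 =
  coblock (a *: P + P2) (a *: H + H2) (a *: G + G2) (a *: G' + G2')
          (a *: Q + Q2) (a *: K + K2).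
Proof.
apply: eq_shift4 => s t k s' t' l; rewrite mxE [X in X + _]mxE !coblockE.
by case: s s' => [] [] /=; rewrite !mxE; ring.
Qed.

Lemma coblock_tr P H G G' Q K :
  (coblock P H G G' Q K)^T = coblock P^T H^T G'^T G^T Q^T K^T.
Proof.
apply: eq_shift4 => s t k s' t' l; rewrite mxE !coblockE addbC.
by case: s s' => [] [] /=; rewrite !mxE.
Qed.

Lemma coblock_schur P H G G' Q K P2 H2 G2 G2' Q2 K2 :
  coblock P H G G' Q K ⊙ coblock P2 H2 G2 G2' Q2 K2 =
  coblock (P ⊙ P2 + H ⊙ H2) (P ⊙ H2 + H ⊙ P2) (G ⊙ G2) (G' ⊙ G2')
          (Q ⊙ Q2 + K ⊙ K2) (Q ⊙ K2 + K ⊙ Q2).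
Proof.
apply: eq_shift4 => s t k s' t' l; rewrite schurE !coblockE.
by case: s s' => [] [] /=; rewrite !mxE //; case: (t (+) t') => /=; ring.
Qed.

(** The blocks [P], [G], [G'], [Q] act on even vectors and [H], [K] on odd ones, so all mixed
    products cancel. *)
Lemma coblock_mul P H G G' Q K P2 H2 G2 G2' Q2 K2 :
  coblock P H G G' Q K *m coblock P2 H2 G2 G2' Q2 K2 =
  coblock (2%:R *: (P *m P2 + G *m G2')) (2%:R *: (H *m H2))
          (2%:R *: (P *m G2 + G *m Q2)) (2%:R *: (G' *m P2 + Q *m G2'))
          (2%:R *: (G' *m G2 + Q *m Q2)) (2%:R *: (K *m K2)).
Proof.
rewrite /coblock /block4 !mulmx_block !add_block_mx.
rewrite !(mulmxDl, mulmxDr, mulmxBl, mulmxBr, mulNmx, mulmxN).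
(* The matrix products are made opaque, so that their entries are atoms for [ring]. *)
move: (P *m P2) (G *m G2') (H *m H2) (P *m G2) (G *m Q2) (G' *m P2) (Q *m G2')
  (G' *m G2) (Q *m Q2) (K *m K2) (P *m H2) (H *m P2) (Q *m K2) (K *m Q2)
  (H *m G2) (K *m G2') (G *m K2) (G' *m H2).
move=> *; congr block_mx; congr block_mx; apply/matrixP => i j; rewrite !mxE; ring.
Qed.

(** The blocks [P + H] and [P - H] must be 1 and 0, whence the halves. *)
Lemma coblock_1 (two_neq0 : 2%:R != 0 :> C) :
  1%:M = coblock (2%:R^-1)%:M (2%:R^-1)%:M 0 0 (2%:R^-1)%:M (2%:R^-1)%:M.
Proof.
have h : 2%:R^-1 + 2%:R^-1 = 1 :> C.
  by rewrite -mulr2n -[2%:R^-1 *+ 2]mulr_natl divff.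
rewrite /coblock /block4 subrr -!raddfD /= h.
by rewrite !scalar_mx_block !block_mx0.
Qed.

Lemma coblock_J : const_mx 1 =
  coblock (const_mx 1) 0 (const_mx 1) (const_mx 1) (const_mx 1) 0.
Proof.
apply: eq_shift4 => s t k s' t' l; rewrite coblockE !mxE.
by case: s s' => [] [] /=; rewrite ?mulr0 ?addr0.
Qed.

Lemma coblock_even P H G G' Q K u v :
  coblock P H G G' Q K *m vec4 u u v v =
  vec4 (2%:R *: (P *m u + G *m v)) (2%:R *: (P *m u + G *m v))
       (2%:R *: (G' *m u + Q *m v)) (2%:R *: (G' *m u + Q *m v)).
Proof.
rewrite /coblock /block4 /vec4 !mul_block_col !mulmxDl !mulNmx !add_col_mx.
move: (P *m u) (G *m v) (G' *m u) (Q *m v) (H *m u) (K *m v) => *.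
by congr col_mx; congr col_mx; apply/matrixP => i j; rewrite !mxE; ring.
Qed.

Lemma coblock_odd P H G G' Q K u v :
  coblock P H G G' Q K *m vec4 u (- u) v (- v) =
  vec4 (2%:R *: (H *m u)) (- (2%:R *: (H *m u)))
       (2%:R *: (K *m v)) (- (2%:R *: (K *m v))).
Proof.
rewrite /coblock /block4 /vec4 !mul_block_col !mulmxDl !mulNmx !mulmxN !add_col_mx.
move: (P *m u) (G *m v) (G' *m u) (Q *m v) (H *m u) (K *m v) => *.
by congr col_mx; congr col_mx; apply/matrixP => i j; rewrite !mxE; ring.
Qed.

Lemma scale_vec4 a x y z w :
  a *: vec4 x y z w = vec4 (a *: x) (a *: y) (a *: z) (a *: w).
Proof. by rewrite /vec4 !scale_col_mx. Qed.

(** The scalars [a] and [b] are signs, so [b y] can be written as [a (a b y)] and [a y] as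
    [b (a b y)]: both halves then show the same eigenvalue. *)
Lemma coblock_eigen_even P H G G' Q K u v a b x y :
  a * a = 1 -> b * b = 1 ->
  P *m u = x *: u -> G *m v = y *: u -> G' *m u = y *: v -> Q *m v = x *: v ->
  coblock P H G G' Q K *m vec4 (a *: u) (a *: u) (b *: v) (b *: v) =
  (2%:R * (x + a * b * y)) *: vec4 (a *: u) (a *: u) (b *: v) (b *: v).
Proof.
move=> aa bb Pu Gv Gu Qv; rewrite coblock_even scale_vec4 -!scalemxAr Pu Gv Gu Qv.
have e1 : 2%:R *: (a *: (x *: u) + b *: (y *: u)) =
    2%:R * (x + a * b * y) *: (a *: u).
  rewrite !scalerA -!scalerDl scalerA; congr (_ *: _).
  by transitivity (2%:R * (a * x + (a * a) * b * y)); [rewrite aa|]; ring.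
have e2 : 2%:R *: (a *: (y *: v) + b *: (x *: v)) =
    2%:R * (x + a * b * y) *: (b *: v).
  rewrite !scalerA -!scalerDl scalerA; congr (_ *: _).
  by transitivity (2%:R * (a * (b * b) * y + b * x)); [rewrite bb|]; ring.
by rewrite e1 e2.
Qed.

Lemma coblock_eigen_odd P H G G' Q K u v a b z :
  H *m u = z *: u -> K *m v = z *: v ->
  coblock P H G G' Q K *m vec4 (a *: u) (- (a *: u)) (b *: v) (- (b *: v)) =
  (2%:R * z) *: vec4 (a *: u) (- (a *: u)) (b *: v) (- (b *: v)).
Proof.
move=> Hu Kv; rewrite coblock_odd scale_vec4 -!scalemxAr Hu Kv !scalerN !scalerA.
by rewrite ![_ * z * _]mulrAC.
Qed.

End BlockStructure.

(** * The matrix V is type-II; its quotients of columns *)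

Section TypeIIV.
Variables (C : fieldType) (n : nat) (d : C) (A B : 'M[C]_n).
Hypotheses (n_neq0 : n%:R != 0 :> C) (d_neq0 : d != 0).
Hypotheses (tA : type2 A) (tB : type2 B).

Lemma V_mxE s t k s' t' l : V_mx d A B (shift4 s t k) (shift4 s' t' l) =
  if s == s' then (-1) ^+ (t (+) t') * (d * A k l)
  else if s then (B l k)^-1 else (B k l)^-1.
Proof.
case: s t s' t' => [] [] [] []; rewrite /V_mx /block4 /shift4 /=;
by rewrite ?(block_mxEul, block_mxEur, block_mxEdl, block_mxEdr) !mxE
  ?(expr0, expr1, mul1r, mulN1r).
Qed.

Lemma signVr (b : bool) : ((-1) ^+ b)^-1 = (-1) ^+ b :> C.
Proof. by case: b; rewrite ?invr1 // expr1 invrN1. Qed.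

Lemma V_mx_nz : nowhere_zero (V_mx d A B).
Proof.
move=> i j; have [s [t [k ->]]] := shift4P i; have [s' [t' [l ->]]] := shift4P j.
rewrite V_mxE; case: s s' => [] [] /=;
by rewrite ?invr_eq0 ?mulf_neq0 ?signr_eq0 // ?tA.1 ?tB.1.
Qed.

Lemma V_mx_inv_tr : (V_mx d A B)^s^T =
  block4 (d^-1 *: A^s^T) (- (d^-1 *: A^s^T)) B B
         (- (d^-1 *: A^s^T)) (d^-1 *: A^s^T) B B
         B^T B^T (d^-1 *: A^s^T) (- (d^-1 *: A^s^T))
         B^T B^T (- (d^-1 *: A^s^T)) (d^-1 *: A^s^T).
Proof.
apply: eq_shift4 => s t k s' t' l; rewrite mxE schur_invE V_mxE.
case: s t s' t' => [] [] [] []; rewrite /block4 /shift4 /=;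
by rewrite ?(block_mxEul, block_mxEur, block_mxEdl, block_mxEdr) ?mxE
  ?invrK // !invfM ?(expr0, expr1, invr1, mul1r, invrN1, mulN1r).
Qed.

(** Blocks from [A] and from [B] each contribute [2n] to the diagonal and opposite amounts next to
    it; terms mixing [A] with [B] cancel by sign. *)
Lemma V_mx_type2 : type2 (V_mx d A B).
Proof.
split; first exact: V_mx_nz.
rewrite V_mx_inv_tr /V_mx /block4 !mulmx_block !add_block_mx.
have e1 : (d *: A) *m (d^-1 *: A^s^T) = n%:R%:M.
  by rewrite -scalemxAl -scalemxAr scalerA divff // scale1r tA.2.
have e2 : B^s *m B^T = n%:R%:M.
  by have [_] := type2_inv tB; rewrite schur_invK.
have e3 : B^s^T *m B = n%:R%:M by exact: type2_mulVmx.
rewrite !(mulNmx, mulmxN) opprK e1 e2 e3 !addNr !subrr !addr0.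
rewrite !natrD !raddfD /= !scalar_mx_block !add_block_mx !addr0.
by rewrite -!opprD addNr subrr !block_mx0.
Qed.

(** For two columns in the same half, the sign depending on the row occurs twice or not at all,
    which makes the vector even. For columns in different halves it occurs once, which makes the
    vector odd. *)
Lemma nomura_vec_V00 t t' i j :
  nomura_vec (V_mx d A B) (V_mx d A B)^s (shift4 false t i) (shift4 false t' j) =
  let u := nomura_vec A A^s i j in let v := nomura_vec B^s^T B^T i j in
  vec4 ((-1) ^+ (t (+) t') *: u) ((-1) ^+ (t (+) t') *: u) v v.
Proof.
apply: eq_shift4_mx => s r k l.
rewrite nomura_vecE schur_invE !V_mxE vec4E.
case: s r => [] [] /=; rewrite !mxE ?invrK // !invfM signVr.
all: by case: t t' => [] [] /=; rewrite ?(expr0, expr1); field; rewrite d_neq0 tA.1.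
Qed.

Lemma nomura_vec_V11 t t' i j :
  nomura_vec (V_mx d A B) (V_mx d A B)^s (shift4 true t i) (shift4 true t' j) =
  let u := nomura_vec B^s B i j in let v := nomura_vec A A^s i j in
  vec4 u u ((-1) ^+ (t (+) t') *: v) ((-1) ^+ (t (+) t') *: v).
Proof.
apply: eq_shift4_mx => s r k l.
rewrite nomura_vecE schur_invE !V_mxE vec4E.
case: s r => [] [] /=; rewrite !mxE ?invrK // !invfM signVr.
all: by case: t t' => [] [] /=; rewrite ?(expr0, expr1); field; rewrite d_neq0 tA.1.
Qed.

Lemma nomura_vec_V01 t t' i j :
  nomura_vec (V_mx d A B) (V_mx d A B)^s (shift4 false t i) (shift4 true t' j) =
  let u := ((-1) ^+ t * d) *: nomura_vec A B i j in
  let v := ((-1) ^+ t' * d^-1) *: nomura_vec B^s^T A^s i j in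
  vec4 u (- u) v (- v).
Proof.
apply: eq_shift4_mx => s r k l.
rewrite nomura_vecE schur_invE !V_mxE vec4E.
case: s r => [] [] /=; rewrite !mxE ?invrK ?invfM ?signVr.
all: by case: t t' => [] [] /=; rewrite ?(expr0, expr1); ring.
Qed.

Lemma nomura_vec_V10 t t' i j :
  nomura_vec (V_mx d A B) (V_mx d A B)^s (shift4 true t i) (shift4 false t' j) =
  let u := ((-1) ^+ t' * d^-1) *: nomura_vec B^s A^s i j in
  let v := ((-1) ^+ t * d) *: nomura_vec A B^T i j in
  vec4 u (- u) v (- v).
Proof.
apply: eq_shift4_mx => s r k l.
rewrite nomura_vecE schur_invE !V_mxE vec4E.
case: s r => [] [] /=; rewrite !mxE ?invrK ?invfM ?signVr.
all: by case: t t' => [] [] /=; rewrite ?(expr0, expr1); ring.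
Qed.

End TypeIIV.

(** * Membership of block matrices in N_V and the subscheme property *)

Section SubschemeOfV.
Variables (C : fieldType) (n : nat) (d : C) (A B : 'M[C]_n).
Hypotheses (n_neq0 : n%:R != 0 :> C) (two_neq0 : 2%:R != 0 :> C) (d_neq0 : d != 0).
Hypotheses (symA : A^T = A) (tA : type2 A) (tB : type2 B).
Hypotheses (hAB : nomura_pair A B A B) (hABT : nomura_pair A B^T A B^T).
Implicit Types F P H G Q K : 'M[C]_n.

Local Notation V := (V_mx d A B).

Let tA' : type2 A^s := type2_inv tA.
Let tB' : type2 B^s := type2_inv tB.
Let tBT : type2 B^T := type2_tr n_neq0 tB.
Let tBT' : type2 B^s^T := type2_tr n_neq0 tB'.
Let tV : type2 V := V_mx_type2 n_neq0 d_neq0 tA tB.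

Lemma size_V_neq0 : ((n + n) + (n + n))%:R != 0 :> C.
Proof.
by rewrite !addnn -!mul2n !natrM !mulf_neq0.
Qed.

(** The hypotheses follow the four families of vectors: both columns in the first half ([X], [Y]),
    both in the second ([X'], [Y']), and the two mixed orders ([Z], [Z']). *)
Lemma nomura_V_coblock P H G G' Q K X X' Y Y' Z Z' :
  nomura_pair A A^s P X -> nomura_pair B^s^T B^T Q X ->
  star_triangle G Y B^s^T B^T A A^s -> star_triangle G' Y A A^s B^s^T B^T ->
  nomura_pair A A^s Q X' -> nomura_pair B^s B P X' ->
  star_triangle G Y' A A^s B^s B -> star_triangle G' Y' B^s B A A^s ->
  nomura_pair A B H Z -> nomura_pair B^s^T A^s K Z ->
  nomura_pair A B^T K Z' -> nomura_pair B^s A^s H Z' ->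
  nomura V (coblock P H G G' Q K).
Proof.
move=> PX QX GY GY' QX' PX' GY2 GY2' HZ KZ KZ' HZ' i j.
split.
  apply: nomura_vec_neq0 (type2_unit size_V_neq0 tV) _.
  exact: nowhere_zero_inv tV.1.
have [s [t [k ->]]] := shift4P i; have [s' [t' [l ->]]] := shift4P j.
have sgn (b : bool) : (-1) ^+ b * (-1) ^+ b = 1 :> C.
  by rewrite -signr_addb addbb.
case: s s' => [] [].
- rewrite nomura_vec_V11 //=; eexists.
  rewrite -[nomura_vec B^s B k l]scale1r.
  exact: (coblock_eigen_even _ _ (mulr1 1) (sgn _)
    (PX' k l) (GY2 k l) (GY2' k l) (QX' k l)).
- by rewrite nomura_vec_V10 //=; eexists;
  apply: coblock_eigen_odd (HZ' k l) (KZ' k l).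
- by rewrite nomura_vec_V01 //=; eexists;
  apply: coblock_eigen_odd (HZ k l) (KZ k l).
rewrite nomura_vec_V00 //=; eexists.
rewrite -[nomura_vec B^s^T B^T k l]scale1r.
exact: (coblock_eigen_even _ _ (sgn _) (mulr1 1)
  (PX k l) (GY k l) (GY' k l) (QX k l)).
Qed.

Lemma calM_nomura F G H : nomura A F -> nomura2 A B G -> nomura2 A B H ->
  nomura V (calM A B F G H).
Proof.
move=> hF hG hH.
have /nomuraP[//|//|P hP] := hF.
have /(nomura_eq n_neq0 symA tA tB hAB)/nomuraP[//|//|Q hQ] := hF.
have tF : Theta A F = P by apply: (Theta2P n_neq0 tA tA').
have tFB : Theta B^s F = Q by apply: Theta2P hQ => //; apply: type2_inv.
rewrite schur_invK in hQ.
have [F' [hQF' hPF' _]] := Theta_comm n_neq0 symA tA tB hAB hABT hP hQ.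
have [L [T [U [hT hLT hU hLU]]]] := pairing_ex n_neq0 symA tA tB hAB hABT hG.
have [K [T2 [U2 [hT2 hK hU2 hKU]]]] := pairing_ex n_neq0 symA tA tB hAB hABT hH.
rewrite /calM tF tFB (pairedP n_neq0 tA tB hT2 hK).
rewrite (Theta2P n_neq0 tA tB hT) (Theta2P n_neq0 tA tB hU).
(* The coefficients come from duality: [F'] is the common double image of [F] divided by [n], and
   [L] is the matrix paired with [G]. *)
apply: (@nomura_V_coblock P H T U^T Q K (n%:R *: F^T) (n%:R *: F')
  (n%:R *: G^T) (n%:R *: L^T) T2 U2^T).
- by have := nomura_dual n_neq0 tA hP; rewrite symA.
- have := nomura_dual n_neq0 tB'; rewrite schur_invK -!tr_schur_inv schur_invK.
  exact.
- move/(nomura_pair_dual n_neq0 _ _ tA tB)/star_triangle_swap: hT.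
  by rewrite linearZ /= [A^s^T]tr_schur_inv symA.
- move/(nomura_pair_dual_swap n_neq0 _ _ tA tB): hU.
  by rewrite [A^s^T]tr_schur_inv symA.
- exact: hQF'.
- exact: hPF'.
- move/(nomura_pair_dual_swap n_neq0 _ _ tA tBT): hLT.
  by rewrite !tr_schur_inv !trmxK symA.
- move/(nomura_pair_dual n_neq0 _ _ tA tBT)/star_triangle_swap: hLU.
  by rewrite linearZ /= !tr_schur_inv !trmxK symA.
- exact: hT2.
- apply/nomura_pair_swap.
  by move/(nomura_pair_tr n_neq0 tA tBT.1): hK; rewrite trmxK tr_schur_inv.
- exact: hKU.
apply/nomura_pair_swap; move/(nomura_pair_tr n_neq0 tA tB.1): hU2.
by rewrite !trmxK.
Qed.

Lemma sum_diff_solve (p g u : 'cV[C]_n) (a b : C) :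
  2%:R *: (p + g) = a *: u -> 2%:R *: (- p + g) = - b *: u ->
  p = ((a + b) / 4%:R) *: u /\ g = ((a - b) / 4%:R) *: u.
Proof.
have four_neq0 : 4%:R != 0 :> C by rewrite (natrM _ 2 2) mulf_neq0.
move=> e1 e2.
split; apply: (scalerI four_neq0).
  rewrite scalerA mulrCA divff // mulr1 [(a + b) *: u]scalerDl
    -e1 -[b]opprK scaleNr -e2.
  by apply/matrixP => i j; rewrite !mxE; ring.
rewrite scalerA mulrCA divff // mulr1 [(a - b) *: u]scalerDl -e1 -e2.
by apply/matrixP => i j; rewrite !mxE; ring.
Qed.

Lemma vec4_inj (x y z w x' y' z' w' : 'cV[C]_n) :
  vec4 x y z w = vec4 x' y' z' w' -> x = x' /\ z = z'.
Proof. by move=> /eq_col_mx[/eq_col_mx[-> _] /eq_col_mx[-> _]]. Qed.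

(** Eigenvalues for columns of the first quarter of V against the first three quarters already
    determine [F], [G] and the partner of [H]. *)
Lemma coblock_calB P H G G' Q K :
  nomura V (coblock P H G G' Q K) -> calB A B (coblock P H G G' Q K).
Proof.
move=> /(nomuraP size_V_neq0 _ tV) [L hL].
(* [L0] and [L1] belong to even vectors with the same [u], [v] and opposite relative signs. They
   should equal [2 (X + Y)] and [2 (X - Y)], which is solved for [X] and [Y]. *)
pose L0 i j := L (shift4 false false i) (shift4 false false j).
pose L1 i j := L (shift4 false false i) (shift4 false true j).
pose Z := \matrix_(i, j) (2%:R^-1 * L (shift4 false false i) (shift4 true false j)).
pose X := \matrix_(i, j) ((L0 i j + L1 i j) / 4%:R).
pose Y := \matrix_(i, j) ((L0 i j - L1 i j) / 4%:R).
have [PX QX GY GY'] : [/\ nomura_pair A A^s P X, nomura_pair B^s^T B^T Q X,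
    star_triangle G Y B^s^T B^T A A^s & star_triangle G' Y A A^s B^s^T B^T].
  suff e i j : let u := nomura_vec A A^s i j in let v := nomura_vec B^s^T B^T i j in
      (P *m u = X i j *: u /\ G *m v = Y i j *: u) /\
      (G' *m u = Y i j *: v /\ Q *m v = X i j *: v).
    by split=> i j; have [[? ?] [? ?]] := e i j.
  move=> u v; rewrite !mxE.
  have := hL (shift4 false false i) (shift4 false false j).
  rewrite nomura_vec_V00 //= expr0 scale1r coblock_even scale_vec4.
  move=> /vec4_inj [e1 e2].
  have := hL (shift4 false false i) (shift4 false true j).
  rewrite nomura_vec_V00 //= expr1 scaleN1r coblock_even scale_vec4 !mulmxN scalerN.
  move=> /vec4_inj [e3 e4]; rewrite -scaleNr in e3.
  split; first exact: sum_diff_solve.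
  (* In the lower half the sign change affects [G'] instead of the diagonal block, so [L1] enters
     negated and [X], [Y] trade places. *)
  by have := @sum_diff_solve _ _ v (L0 i j) (- L1 i j) e2; rewrite opprK; apply.
have [HZ KZ] : nomura_pair A B H Z /\ nomura_pair B^s^T A^s K Z.
  suff e i j : let u := nomura_vec A B i j in let v := nomura_vec B^s^T A^s i j in
      H *m u = Z i j *: u /\ K *m v = Z i j *: v.
    by split=> i j; have [? ?] := e i j.
  move=> u v; rewrite !mxE.
  have := hL (shift4 false false i) (shift4 true false j).
  rewrite nomura_vec_V01 //= expr0 !mul1r coblock_odd scale_vec4.
  have half (M : 'M[C]_n) (x : 'cV[C]_n) (l a : C) : a != 0 ->
      2%:R *: (M *m (a *: x)) = l *: (a *: x) -> M *m x = (2%:R^-1 * l) *: x.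
    move=> a0; rewrite -scalemxAr !scalerA => e.
    apply: (scalerI (mulf_neq0 two_neq0 a0)); rewrite e scalerA.
    by congr (_ *: _); field.
  move=> /vec4_inj [/(half _ _ _ _ d_neq0) -> e2]; split=> //.
  exact: half (invr_neq0 d_neq0) e2.
(* Duality makes [X] and [Y] equal to [n F^T] and [n G^T], which dictates the candidates for [F] and
   [G]. *)
have FP : nomura_pair A A^s (n%:R^-1 *: X^T) P.
  have := nomura_dual n_neq0 tA PX; rewrite symA => /(nomura_tr n_neq0 tA).
  by rewrite linearZ /= trmxK => /(star_triangleZ n%:R^-1); rewrite scalerK.
have FQ : nomura_pair B^s B^s^s (n%:R^-1 *: X^T) Q.
  have := nomura_dual n_neq0 tBT'.
  rewrite -!tr_schur_inv schur_invK !trmxK => /(_ _ _ QX).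
  have := nomura_tr n_neq0 tB'; rewrite schur_invK => h /h.
  by rewrite linearZ /= trmxK => /(star_triangleZ n%:R^-1); rewrite scalerK.
have GG : nomura_pair A B (n%:R^-1 *: Y^T) G.
  apply/(nomura_pair_dual n_neq0) => //; rewrite scalerA divff // scale1r.
  by rewrite [A^s^T]tr_schur_inv symA; apply: star_triangle_swap.
have GG' : nomura_pair A B (n%:R^-1 *: Y^T)^T G'^T.
  apply/(nomura_pair_dual_swap n_neq0) => //.
  rewrite linearZ /= !trmxK scalerA divff // scale1r.
  by rewrite [A^s^T]tr_schur_inv symA.
have HK : nomura_pair A B^T K^T Z^T.
  apply/nomura_pair_swap; rewrite trmxK.
  have := nomura_pair_tr n_neq0 tBT' tA'.1 KZ.
  by rewrite -tr_schur_inv !schur_invK.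
exists (n%:R^-1 *: X^T), (n%:R^-1 *: Y^T), H; split.
- by apply/nomuraP => //; exists P.
- by apply/nomura_pairP => //; exists G.
- by apply/nomura_pairP => //; exists Z.
rewrite /calM /Theta (Theta2P n_neq0 tA tA' FP).
rewrite (Theta2P n_neq0 tB' (type2_inv tB') FQ).
rewrite (Theta2P n_neq0 tA tB GG) (Theta2P n_neq0 tA tB GG') trmxK.
by rewrite (pairedP n_neq0 tA tB HZ HK).
Qed.

Lemma calB_iff M : calB A B M <->
  nomura V M /\ exists P H G G' Q K, M = coblock P H G G' Q K.
Proof.
split=> [[F [G [H [hF hG hH ->]]]] | [hM [P [H [G [G' [Q [K e]]]]]]]].
  split; first exact: calM_nomura.
  by do 6!eexists.
by move: hM; rewrite e; apply: coblock_calB.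
Qed.

Lemma calB_subscheme : subscheme (calB A B) (nomura V).
Proof.
have bV := nomura_bose_mesner size_V_neq0 tV.
split; last by move=> M /calB_iff [].
split.
- move=> a X Y /calB_iff [hX [P [H [G [G' [Q [K eX]]]]]]].
  move=> /calB_iff [hY [P2 [H2 [G2 [G2' [Q2 [K2 eY]]]]]]].
  apply/calB_iff; split; first exact: (bm_lin bV).
  by rewrite eX eY coblock_lin; do 6!eexists.
- apply/calB_iff; split; first exact: (bm_I bV).
  by rewrite (coblock_1 n two_neq0); do 6!eexists.
- apply/calB_iff; split; first exact: (bm_J bV).
  by rewrite coblock_J; do 6!eexists.
- move=> X /calB_iff [hX [P [H [G [G' [Q [K eX]]]]]]].
  apply/calB_iff; split; first exact: (bm_tr bV).
  by rewrite eX coblock_tr; do 6!eexists.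
- move=> X Y /calB_iff [hX [P [H [G [G' [Q [K eX]]]]]]].
  move=> /calB_iff [hY [P2 [H2 [G2 [G2' [Q2 [K2 eY]]]]]]].
  apply/calB_iff; split; first exact: (bm_schur bV).
  by rewrite eX eY coblock_schur; do 6!eexists.
- move=> X Y /calB_iff [hX [P [H [G [G' [Q [K eX]]]]]]].
  move=> /calB_iff [hY [P2 [H2 [G2 [G2' [Q2 [K2 eY]]]]]]].
  apply/calB_iff; split; first exact: (bm_mul bV).
  by rewrite eX eY coblock_mul; do 6!eexists.
by move=> X Y /calB_iff [hX _] /calB_iff [hY _]; apply: (bm_comm bV).
Qed.

End SubschemeOfV.

(** * Invertible Jones pairs consist of type-II matrices *)

Section JonesType2.
Variables (C : fieldType) (n : nat).
Hypothesis n_neq0 : n%:R != 0 :> C.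
Implicit Types A B N P : 'M[C]_n.

Lemma op_X_unit A : bijective (op_X A) -> A \in unitmx.
Proof. by case=> g _ h; have /mulmx1_unit[] := h 1%:M. Qed.

Lemma op_Delta_nz B : bijective (op_Delta B) -> nowhere_zero B.
Proof.
move=> /bij_inj inj i j; apply/eqP => b0.
have /inj/matrixP/(_ i j)/eqP : op_Delta B (delta_mx i j) = op_Delta B 0.
  apply/matrixP => k l; rewrite !mxE mulr0.
  by case: eqP => [->|]; case: eqP => [->|]; rewrite ?b0 ?mul0r ?mulr0.
by rewrite !mxE !eqxx oner_eq0.
Qed.

(** Evaluate the braid relation at the matrix unit [delta_mx i j] and read off entry [(k, j)]. *)
Lemma braid_nomura_pair A B :
  op_X A \o op_Delta B \o op_X A =1 op_Delta B \o op_X A \o op_Delta B ->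
  nomura_pair A B A B.
Proof.
move=> h; apply/star_triangleP => k i j.
have e (M : 'M[C]_n) l : (M *m delta_mx i j) l j = M l i.
  rewrite mxE (bigD1 i) //= big1 ?addr0 => [|r /negPf ri].
    by rewrite !mxE !eqxx mulr1.
  by rewrite !mxE ri mulr0.
have Bd : B ⊙ delta_mx i j = B i j *: delta_mx i j.
  apply/matrixP => r l; rewrite !mxE.
  by case: eqP => [->|_]; case: eqP => [->|_]; rewrite ?mulr0.
have : (A *m (B ⊙ (A *m delta_mx i j))) k j =
       (B ⊙ (A *m (B ⊙ delta_mx i j))) k j.
  by have /matrixP := h (delta_mx i j); apply.
rewrite Bd -scalemxAr schurE [(B i j *: (A *m delta_mx i j)) k j]mxE e mxE => h'.
transitivity (B k j * (B i j * A k i)); last by ring.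
by rewrite -h'; apply: eq_bigr => l _; rewrite schurE e; ring.
Qed.

Lemma type2_of_flat P : nowhere_zero P -> P \in unitmx ->
  (forall k l, P k l * invmx P l k = n%:R^-1) -> type2 P.
Proof.
move=> hP uP h; split=> //.
suff -> : P^s^T = n%:R *: invmx P.
  by rewrite -scalemxAr mulmxV // scale_scalar_mx mulr1.
apply/matrixP => l k; rewrite !mxE; apply: (mulfI (hP k l)).
by rewrite mulrCA h !divff.
Qed.

(** The all-ones row is a left eigenvector of [B], with nonzero eigenvalue [t]. Cancelling [B] thus
    makes each row of [N] constant, and row sum 1 fixes the constant. *)
Lemma constant_rows_flat N B (a : 'I_n -> C) t : B \in unitmx ->
  (forall j, \sum_i B i j = t) ->
  N *m B = \matrix_(k, j) a k -> (forall k, \sum_l N k l = 1) ->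
  forall k l, N k l = n%:R^-1.
Proof.
move=> uB colB NB rowN k l.
have oneB : (const_mx 1 : 'rV_n) *m B = t *: const_mx 1.
  apply/rowP => j; rewrite !mxE mulr1 -(colB j).
  by apply: eq_bigr => i _; rewrite mxE mul1r.
have t0 : t != 0.
  apply/eqP => t0; move: oneB; rewrite t0 scale0r => /(congr1 (mulmx^~ (invmx B))).
  rewrite mulmxK // mul0mx => /rowP /(_ k) /eqP.
  by rewrite !mxE oner_eq0.
have eN : N = \matrix_(k, l) (t^-1 * a k).
  apply: (can_inj (mulmxK uB)); rewrite NB; apply/matrixP => i j; rewrite !mxE.
  under eq_bigr => r _ do rewrite mxE.
  by rewrite -mulr_sumr colB mulrC mulVKf.
move: (rowN k); rewrite eN mxE; under eq_bigr => r _ do rewrite mxE.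
rewrite sumr_const card_ord => h.
by apply: (mulfI n_neq0); rewrite mulr_natl h divff.
Qed.

Lemma sum_schur_invmx B k : B \in unitmx -> \sum_j B k j * invmx B j k = 1.
Proof.
by move=> uB; have /matrixP/(_ k k) := mulmxV uB; rewrite !mxE eqxx.
Qed.

(** For fixed [k] and [i] the star-triangle relation equates two row vectors; multiply by the
    inverse of [B], take coordinate [k] and cancel [A k i]. *)
Lemma nomura_pair_diag_B A B : nowhere_zero A -> B \in unitmx ->
  nomura_pair A B A B ->
  (B ⊙ (invmx B)^T) *m B^T = \matrix_(k, i) A k k.
Proof.
move=> hA uB /star_triangleP st; apply/matrixP => k i; rewrite !mxE.
have : (\row_l (A k l * A l i)) *m B = \row_j (B i j * (A k i * B k j)).
  apply/rowP => j; rewrite !mxE -st.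
  by apply: eq_bigr => l _; rewrite mxE mulrA.
move/(congr1 (mulmx^~ (invmx B))); rewrite mulmxK // => /rowP /(_ k).
rewrite !mxE => h; apply: (mulIf (hA k i)); rewrite h mulr_suml.
by apply: eq_bigr => j _; rewrite !mxE; ring.
Qed.

Lemma nomura_pair_diag_A A B : A \in unitmx -> nowhere_zero B ->
  nomura_pair A B A B ->
  (A ⊙ (invmx A)^T) *m B = \matrix_(k, j) A k k.
Proof.
move=> uA hB /star_triangleP st; apply/matrixP => k j; rewrite !mxE.
have : (\row_l (A k l * B l j)) *m A = \row_i (B i j * (A k i * B k j)).
  apply/rowP => i; rewrite !mxE -st.
  by apply: eq_bigr => l _; rewrite mxE; ring.
move/(congr1 (mulmx^~ (invmx A))); rewrite mulmxK // => /rowP /(_ k).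
rewrite !mxE => h; apply: (mulIf (hB k j)); rewrite h mulr_suml.
by apply: eq_bigr => i _; rewrite !mxE; ring.
Qed.

(** Row [i] of [B] lists the eigenvalues of [A] on the basis [A e_i o B e_j], so its sum is the
    trace. *)
Lemma nomura_pair_row_sum A B i : nowhere_zero A -> B \in unitmx ->
  nomura_pair A B A B -> \sum_j B i j = \tr A.
Proof.
move=> hA uB st.
have /matrixP e := nomura_pair_diag_B hA uB st.
transitivity (\sum_k \sum_j (B k j * invmx B j k) * B i j); last first.
  apply: eq_bigr => k _; move: (e k i); rewrite !mxE => <-.
  by apply: eq_bigr => j _; rewrite !mxE.
rewrite exchange_big; apply: eq_bigr => j _ /=; rewrite -mulr_suml.
have /matrixP/(_ j j) := mulVmx uB; rewrite !mxE eqxx => e1.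
by under eq_bigr => k _ do rewrite mulrC; rewrite e1 mul1r.
Qed.

(** The braid relation for [B] gives its row sums, the one for [B^T] its column sums. Column sums
    then yield flatness for [A], and row sums for [B]. *)
Lemma invertible_jones_pair_type2 A B : invertible_jones_pair A B ->
  [/\ type2 A, type2 B, nomura_pair A B A B & nomura_pair A B^T A B^T].
Proof.
case=> -[/op_X_unit uA /op_Delta_nz hB].
move=> /braid_nomura_pair st /braid_nomura_pair stT hA uB.
have uBT : B^T \in unitmx by rewrite unitmx_tr.
have rowB i := nomura_pair_row_sum i hA uB st.
have colB j : \sum_i B i j = \tr A.
  rewrite -(nomura_pair_row_sum j hA uBT stT).
  by apply: eq_bigr => i _; rewrite mxE.
have sumN P : P \in unitmx -> forall k, \sum_l (P ⊙ (invmx P)^T) k l = 1.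
  move=> uP k; rewrite -[RHS](sum_schur_invmx k uP).
  by apply: eq_bigr => l _; rewrite !mxE.
split=> //; apply: type2_of_flat => // k l.
  have := constant_rows_flat uB colB (nomura_pair_diag_A uA hB st) (sumN _ uA) k l.
  by rewrite !mxE.
have rowBT j : \sum_i B^T i j = \tr A.
  by rewrite -(rowB j); apply: eq_bigr => i _; rewrite mxE.
have := constant_rows_flat uBT rowBT (nomura_pair_diag_B hA uB st) (sumN _ uB) k l.
by rewrite !mxE.
Qed.

End JonesType2.

(** Size 0 is treated apart because the general argument divides by [n]; here all matrices
    coincide. *)
Lemma calB_subscheme_0 (C : fieldType) (d : C) (A B : 'M[C]_0) :
  subscheme (calB A B) (nomura (V_mx d A B)).
Proof.
have all0 (X : 'M[C]_((0 + 0) + (0 + 0))) : calB A B X.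
  by exists 0, 0, 0; split; [case|case|case|apply/matrixP; case].
split; last by move=> M _ [].
by split=> // X Y _ _; apply/matrixP; case.
Qed.

Theorem theorem7p6 (R : realType) (n : nat) (A B : 'M[R[i]]_n) (d : R[i])
  (hAB : invertible_jones_pair A B) (hA : A^T = A) (hd : d ^+ 2 = n%:R) :
  subscheme (calB A B) (nomura (V_mx d A B)).
Proof.
case: n A B hAB hA hd => [|n] A B hAB hA hd; first exact: calB_subscheme_0.
have n_neq0 : n.+1%:R != 0 :> R[i] by rewrite pnatr_eq0.
have [tA tB st stT] := invertible_jones_pair_type2 n_neq0 hAB.
apply: calB_subscheme => //; first by rewrite pnatr_eq0.
by apply: contraNneq n_neq0 => d0; rewrite -hd d0 expr0n.
Qed.
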